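(* Let $\mathcal{B}\in\mathbb{C}^{\mathbf{I}(M)\times\mathbf{J}(N)}$ and $\mathcal{W}\in\mathbb{C}^{\mathbf{J}(N)\times\mathbf{I}(M)}$. The tensor $\mathcal{X}=\mathcal{B}*_N[(\mathcal{W}*_M\mathcal{B})^{2}]^{D}$ is the unique solution in $\mathbb{C}^{\mathbf{I}(M)\times\mathbf{J}(N)}$ of the following tensor equations: (a) $(\mathcal{B}*_N\mathcal{W})^{k+1}*_M\mathcal{X}*_N\mathcal{W}=(\mathcal{B}*_N\mathcal{W})^{k}$ for some positive integer $k$, (b) $\mathcal{X}=\mathcal{X}*_N\mathcal{W}*_M\mathcal{B}*_N\mathcal{W}*_M\mathcal{X}$, (c) $\mathcal{B}*_N\mathcal{W}*_M\mathcal{X}=\mathcal{X}*_N\mathcal{W}*_M\mathcal{B}$.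
   Context: For positive integers $I_1,\dots,I_M$ write $\mathbf{I}(M)=I_1\times\cdots\times I_M$; $\mathbb{C}^{\mathbf{I}(M)\times\mathbf{J}(N)}$ is the set of complex tensors with entries $a_{i_1\dots i_M j_1\dots j_N}$, $1\le i_s\le I_s$, $1\le j_s\le J_s$. The Einstein product of $\mathcal{A}\in\mathbb{C}^{\mathbf{I}(M)\times\mathbf{K}(L)}$ and $\mathcal{B}\in\mathbb{C}^{\mathbf{K}(L)\times\mathbf{J}(N)}$ is $(\mathcal{A}*_L\mathcal{B})_{i_1\dots i_M j_1\dots j_N}=\sum_{k_1,\dots,k_L}a_{i_1\dots i_M k_1\dots k_L}b_{k_1\dots k_L j_1\dots j_N}$; similarly $\mathcal{A}*_L\mathcal{X}\in\mathbb{C}^{\mathbf{I}(M)}$ for $\mathcal{X}\in\mathbb{C}^{\mathbf{K}(L)}$. Powers of $\mathcal{A}\in\mathbb{C}^{\mathbf{I}(M)\times\mathbf{I}(M)}$ are taken with $*_M$, and $\mathcal{A}^0$ is the identity tensor. For such $\mathcal{A}$, the range is $\mathfrak{R}(\mathcal{A})=\{\mathcal{A}*_M\mathcal{X}:\mathcal{X}\in\mathbb{C}^{\mathbf{I}(M)}\}$, the index $\mathrm{ind}(\mathcal{A})$ is the smallest nonnegative integer $k$ with $\mathfrak{R}(\mathcal{A}^k)=\mathfrak{R}(\mathcal{A}^{k+1})$, and the Drazin inverse $\mathcal{A}^D$ is the (unique, always existing) $\mathcal{X}\in\mathbb{C}^{\mathbf{I}(M)\times\mathbf{I}(M)}$ with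 $\mathcal{A}^{k+1}*_M\mathcal{X}=\mathcal{A}^k$ (where $k=\mathrm{ind}(\mathcal{A})$), $\mathcal{X}*_M\mathcal{A}*_M\mathcal{X}=\mathcal{X}$, $\mathcal{A}*_M\mathcal{X}=\mathcal{X}*_M\mathcal{A}$. (A tensor satisfying (a)-(c) is what the paper calls the W-weighted Drazin inverse $\mathcal{B}^{D,W}$ of $\mathcal{B}$.) *)

(* Defs.v *)
From HB Require Import structures.
From mathcomp Require Import all_boot all_order all_algebra.
From mathcomp Require Import boolp classical_sets.
Set Implicit Arguments.
Unset Strict Implicit.
Unset Printing Implicit Defensive.
Import Order.TTheory GRing.Theory Num.Theory.
Local Open Scope ring_scope.
Local Open Scope classical_set_scope.

(* Multi-indices (i_1, ..., i_M) with 0 <= i_s < I_s (indices are 0-based). *)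
Definition midx (M : nat) (I : 'I_M -> nat) : finType :=
  {dffun forall s : 'I_M, 'I_(I s)}.

(* Elements of C^{I(M)} and of C^{I(M) x J(N)}; the entry
   a_{i_1 ... i_M j_1 ... j_N} is written A (i, j). *)
Definition tvec (C : fieldType) (M : nat) (I : 'I_M -> nat) :=
  {ffun midx I -> C}.

Definition tensor (C : fieldType) (M N : nat) (I : 'I_M -> nat)
  (J : 'I_N -> nat) := {ffun midx I * midx J -> C}.

Declare Scope tensor_scope.
Delimit Scope tensor_scope with T.

Definition tmul (C : fieldType) (M L N : nat) (I : 'I_M -> nat)
    (K : 'I_L -> nat) (J : 'I_N -> nat)
    (A : tensor C I K) (B : tensor C K J) : tensor C I J :=
  [ffun ij => \sum_(k : midx K) A (ij.1, k) * B (k, ij.2)].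

Definition tapp (C : fieldType) (M L : nat) (I : 'I_M -> nat)
    (K : 'I_L -> nat) (A : tensor C I K) (X : tvec C K) : tvec C I :=
  [ffun i => \sum_(k : midx K) A (i, k) * X k].

Definition tid (C : fieldType) (M : nat) (I : 'I_M -> nat) : tensor C I I :=
  [ffun ij => (ij.1 == ij.2)%:R].

Definition texp (C : fieldType) (M : nat) (I : 'I_M -> nat)
    (A : tensor C I I) (n : nat) : tensor C I I :=
  iter n (tmul A) (tid C I).

Notation "A *E B" := (tmul A B) (at level 40, left associativity)
  : tensor_scope.
Notation "A ^E n" := (texp A n) (at level 29, left associativity)
  : tensor_scope.
Local Open Scope tensor_scope.

Definition trange (C : fieldType) (M : nat) (I : 'I_M -> nat)
    (A : tensor C I I) : set (tvec C I) := range (tapp A).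

Definition is_tind (C : fieldType) (M : nat) (I : 'I_M -> nat)
    (A : tensor C I I) (k : nat) : Prop :=
  trange (A ^E k) = trange (A ^E k.+1) /\
  forall j : nat, trange (A ^E j) = trange (A ^E j.+1) -> (k <= j)%N.

(* The default value 0 of xget is never used: exactly one such k exists. *)
Definition tind (C : fieldType) (M : nat) (I : 'I_M -> nat)
    (A : tensor C I I) : nat := xget 0%N [set k | is_tind A k].

Definition is_drazin (C : fieldType) (M : nat) (I : 'I_M -> nat)
    (A X : tensor C I I) : Prop :=
  [/\ A ^E (tind A).+1 *E X = A ^E (tind A),
      X *E A *E X = X
    & A *E X = X *E A].

(* Likewise, every A has exactly one X with is_drazin A X, so the default
   value 0 is never returned. *)
Definition drazin (C : fieldType) (M : nat) (I : 'I_M -> nat)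
    (A : tensor C I I) : tensor C I I := xget 0 [set X | is_drazin A X].

(* The tensor equations (a)-(c) characterising the W-weighted Drazin inverse;
   the exponent k in (a) is existentially quantified for each X. *)
Definition is_wdrazin (C : fieldType) (M N : nat) (I : 'I_M -> nat)
    (J : 'I_N -> nat) (B : tensor C I J) (W : tensor C J I)
    (X : tensor C I J) : Prop :=
  [/\ exists k : nat, (0 < k)%N /\
        (B *E W) ^E k.+1 *E X *E W = (B *E W) ^E k,
      X = X *E W *E B *E W *E X
    & B *E W *E X = X *E W *E B].

(* Main.v *)
Require Import Defs.
From HB Require Import structures.
From mathcomp Require Import all_boot all_order all_algebra.
From mathcomp Require Import boolp classical_sets reals.
From mathcomp Require Import complex.
Set Implicit Arguments.
Unset Strict Implicit.
Unset Printing Implicit Defensive.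
Import Order.TTheory GRing.Theory Num.Theory.
Local Open Scope ring_scope.
Local Open Scope tensor_scope.

(* Tensors under the Einstein product are matrices indexed by multi-indices.
   For a square A, Cayley-Hamilton gives A^k = A^(k+1) g with g a polynomial
   in A, so A^k g^(k+1) is a Drazin inverse of A.  A Drazin inverse of A^2
   commutes with everything that commutes with A^2, in particular with A; for
   A = W B this yields the three equations for X = B D.  Conversely, if X
   solves them then Y = X W is the Drazin inverse of B W, and
   X = X W (B W X) = Y (X W B) = Y^2 B is determined by Y. *)

(** * Drazin inverses in an arbitrary ring *)

Section RingDrazin.

Variable R : pzRingType.
Implicit Types a c x y g : R.

(** The exponent is existential instead of being the index: the equation passes to all larger
    exponents, so two solutions can be compared at a common one. *)
Definition ring_drazin a x : Prop :=
  [/\ exists k, a ^+ k.+1 * x = a ^+ k, x * a * x = x & GRing.comm a x].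

Lemma ring_drazin_expr_le a x k l : (k <= l)%N ->
  a ^+ k.+1 * x = a ^+ k -> a ^+ l.+1 * x = a ^+ l.
Proof.
by move=> /subnK <- ax; rewrite -addnS !exprD -mulrA ax.
Qed.

Lemma mul_expr_stable a g k n :
  a ^+ k.+1 * g = a ^+ k -> a ^+ (k + n) * g ^+ n = a ^+ k.
Proof.
move=> akg; elim: n => [|n IHn]; first by rewrite addn0 mulr1.
rewrite addnS -addSn addnC exprD (exprS g) mulrA -(mulrA (a ^+ n)) akg.
by rewrite -exprD addnC.
Qed.

Lemma expr_outer_inverse a x n :
  x * a * x = x -> GRing.comm a x -> x ^+ n.+1 * a ^+ n = x.
Proof.
move=> xax cax; elim: n => [|n IHn]; first by rewrite expr1 mulr1.
by rewrite exprS (exprSr a) -mulrA (mulrA (x ^+ n.+1)) IHn -cax mulrA.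
Qed.

(** At a common exponent [n], both inverses equal [x * a * y]: write [x] as [x ^+ n.+1 * a ^+ n] and
    [y] as [a ^+ n * y ^+ n.+1], then absorb the other inverse. *)
Lemma ring_drazin_unique a x y : ring_drazin a x -> ring_drazin a y -> x = y.
Proof.
move=> [[k akx] xax cax] [[l aly] yay cay].
pose n := maxn k l.
have anx : a ^+ n.+1 * x = a ^+ n.
  by apply: ring_drazin_expr_le akx; rewrite leq_maxl.
have any : a ^+ n.+1 * y = a ^+ n.
  by apply: ring_drazin_expr_le aly; rewrite leq_maxr.
have ex := expr_outer_inverse n xax cax.
have ey : a ^+ n * y ^+ n.+1 = y.
  by rewrite (commrX n.+1 (commr_sym (commrX n (commr_sym cay))))
             expr_outer_inverse.
transitivity (x * a * y).
  by rewrite -[in RHS]ex -!mulrA (mulrA _ a y) -exprSr any ex.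
rewrite -[in LHS]ey mulrA -(mulrA x) -exprS.
by rewrite (commrX n.+1 (commr_sym cax)) anx.
Qed.

(** The element [p = a * x] fixes [a ^+ k] on both sides and satisfies [x * p = x = p * x]. Once [c]
    commutes with [p], one gets [c x = p c x = x a c x = x c p = x c]. *)
Lemma ring_drazin_comm a x c : ring_drazin a x -> GRing.comm c a ->
  GRing.comm c x.
Proof.
move=> [[k akx] xax cax] cca.
have ck n : c * a ^+ n = a ^+ n * c by apply: commrX.
have [p pdef] : exists p, p = a * x by exists (a * x).
have akp : a ^+ k * p = a ^+ k by rewrite pdef mulrA -exprSr.
have pE : p = x ^+ k.+1 * a ^+ k.+1.
  by rewrite (exprSr a) mulrA expr_outer_inverse // -cax.
have pE' : p = a ^+ k.+1 * x ^+ k.+1.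
  by rewrite pE; apply: commrX; apply: commr_sym; apply: commrX.
have pak : p * a ^+ k = a ^+ k.
  rewrite -[RHS]akp; apply: commrX; apply: commr_sym.
  by rewrite pdef; apply: commrM.
(* Moving [c] across powers of [a] makes [p * c] end in [a ^+ k.+1], which absorbs [p] on the right;
   dually, [c * p] begins with that power. *)
have pcp : p * c * p = p * c.
  have -> : p * c = x ^+ k.+1 * c * a ^+ k.+1 by rewrite pE -!mulrA ck.
  by rewrite -mulrA (exprS a) -(mulrA a) akp.
have cpc : p * c * p = c * p.
  have cpE : c * p = a ^+ k.+1 * (c * x ^+ k.+1) by rewrite pE' mulrA ck -mulrA.
  by rewrite -mulrA cpE mulrA (exprSr a) (mulrA p) pak.
have cp : c * p = p * c by rewrite -cpc.
have xp : x * p = x by rewrite pdef mulrA.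
have px : p * x = x by rewrite pdef cax.
rewrite /GRing.comm -{1}px mulrA cp pdef cax -(mulrA x) -cca -mulrA.
by rewrite -(mulrA c) -pdef cp mulrA xp.
Qed.

(** Everything reduces to [a ^+ (k + k.+1) * g ^+ k.+1 = a ^+ k], the hypothesis iterated [k.+1]
    times. *)
Lemma ring_drazin_exists a k g : GRing.comm a g ->
  a ^+ k.+1 * g = a ^+ k -> ring_drazin a (a ^+ k * g ^+ k.+1).
Proof.
move=> cag akg.
have akx : a ^+ k.+1 * (a ^+ k * g ^+ k.+1) = a ^+ k.
  by rewrite mulrA -exprD addnC mul_expr_stable.
split.
- by exists k.
- have xE : a ^+ k * g ^+ k.+1 = g ^+ k.+1 * a ^+ k.
    by apply: commrX; apply: commr_sym; apply: commrX.
  by rewrite {1}xE -!mulrA (mulrA a) -exprS (mulrA (a ^+ k)) -exprD mul_expr_stable.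
- by apply: commrM; [apply: commrX | apply: commrX].
Qed.

End RingDrazin.

Lemma mx_strongly_pi_regular (F : fieldType) n (A : 'M[F]_n) :
  exists k, exists2 g : 'M[F]_n, GRing.comm A g & A ^+ k.+1 * g = A ^+ k.
Proof.
case: n A => [|n] A.
  (* In size 0 all matrices are equal, so any witnesses serve. *)
  by exists 0%N, 0; [rewrite /GRing.comm mulr0 mul0r | rewrite [LHS]flatmx0 [RHS]flatmx0].
(* Here [k] is the multiplicity of the root 0, so the cofactor [q] has [q.[0] != 0]. Writing
   [q = c + r * 'X], Cayley-Hamilton reads [c A^k = - h A^(k+1)] with [h = r(A)], and [c] is
   invertible. *)
have [k [q]] := multiplicity_XsubC (char_poly A) 0.
rewrite monic_neq0 ?char_poly_monic //= => q0 cpE.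
have /factor_theorem[r qE] : root (q - q.[0]%:P) 0.
  by rewrite rootE !hornerE subrr.
rewrite subr0 in qE cpE.
pose c := q.[0]; pose h := horner_mx A r.
have cAh : GRing.comm A h by exact: comm_mx_horner.
have qA : horner_mx A q = c%:M + h * A.
  rewrite -[q](subrK c%:P) qE rmorphD rmorphM /= horner_mx_X horner_mx_C.
  by rewrite addrC.
have := Cayley_Hamilton A.
rewrite cpE rmorphM rmorphXn /= horner_mx_X qA mulrDl => /eqP.
rewrite addr_eq0 -scalemx1 -scalerAl mul1r => /eqP cAk.
exists k, (- c^-1 *: h).
  by rewrite /GRing.comm -scalerAr -scalerAl cAh.
rewrite -scalerAr -[RHS](scalerK (a := c)) // cAk scalerN scaleNr.
congr (- (_ *: _)).
by rewrite -mulrA -exprS (commrX k.+1 (commr_sym cAh)).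
Qed.

(** * Transfer between tensors and matrices *)

Definition tmx (C : fieldType) (M N : nat) (I : 'I_M -> nat) (J : 'I_N -> nat)
    (A : tensor C I J) : 'M[C]_(#|midx I|, #|midx J|) :=
  \matrix_(i, j) A (enum_val i, enum_val j).

Section TensorMatrix.

Variable C : fieldType.

Lemma tmx_inj (M N : nat) (I : 'I_M -> nat) (J : 'I_N -> nat) :
  injective (@tmx C M N I J).
Proof.
move=> A A' /matrixP eqA; apply/ffunP=> -[i j].
by have := eqA (enum_rank i) (enum_rank j); rewrite !mxE !enum_rankK.
Qed.

Lemma tmx_surj (M N : nat) (I : 'I_M -> nat) (J : 'I_N -> nat)
    (X : 'M[C]_(#|midx I|, #|midx J|)) : exists A : tensor C I J, tmx A = X.
Proof.
exists [ffun ij => X (enum_rank ij.1) (enum_rank ij.2)].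
by apply/matrixP=> i j; rewrite mxE ffunE !enum_valK.
Qed.

Lemma tmxM (M L N : nat) (I : 'I_M -> nat) (K : 'I_L -> nat)
    (J : 'I_N -> nat) (A : tensor C I K) (B : tensor C K J) :
  tmx (A *E B) = tmx A *m tmx B.
Proof.
apply/matrixP=> i j; rewrite !mxE ffunE /=.
rewrite (reindex _ (onW_bij _ (enum_val_bij _))) /=.
by apply: eq_bigr => k _; rewrite !mxE.
Qed.

Variables (M : nat) (I : 'I_M -> nat).
Implicit Types A X U : tensor C I I.

Lemma tmx1 : tmx (tid C I) = 1.
Proof. by apply/matrixP=> i j; rewrite !mxE ffunE /= (inj_eq enum_val_inj). Qed.

Lemma tmxX A n : tmx (A ^E n) = tmx A ^+ n.
Proof.
by elim: n => [|n IHn]; [apply: tmx1 | rewrite exprS /= tmxM IHn].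
Qed.

Lemma texpD A m n : A ^E (m + n) = A ^E m *E A ^E n.
Proof. by apply: tmx_inj; rewrite tmxM !tmxX exprD. Qed.

Lemma trange_mul A U X : A *E U = X -> (trange X `<=` trange A)%classic.
Proof.
move=> <- _ [v _ <-]; exists (tapp U v) => //.
apply/ffunP=> i; rewrite !ffunE.
under eq_bigr do rewrite ffunE big_distrr /=.
rewrite exchange_big /=; apply: eq_bigr => k _.
by rewrite ffunE big_distrl /=; apply: eq_bigr => l _; rewrite mulrA.
Qed.

Lemma trange_sub A X : (trange X `<=` trange A)%classic ->
  exists U, A *E U = X.
Proof.
move=> sXA.
have colX j : exists v : tvec C I, tapp A v = [ffun i => X (i, j)].
  have [|v _ <-] := sXA [ffun i => X (i, j)]; last by exists v.
  exists [ffun i => (i == j)%:R] => //.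
  apply/ffunP=> i; rewrite !ffunE (bigD1 j) //= ffunE eqxx mulr1.
  by rewrite big1 ?addr0 // => k /negPf kj; rewrite ffunE kj mulr0.
have [u uE] := choice colX.
exists [ffun ij => u ij.2 ij.1]; apply/ffunP=> -[i j]; rewrite ffunE /=.
have /ffunP/(_ i) := uE j; rewrite !ffunE => <-.
by apply: eq_bigr => k _; rewrite ffunE.
Qed.

Lemma trange_expS A k : trange (A ^E k) = trange (A ^E k.+1) <->
  exists U, A ^E k.+1 *E U = A ^E k.
Proof.
split=> [eqr|[U eqU]]; first by apply: trange_sub; rewrite eqr.
apply/seteqP; split; first exact: trange_mul eqU.
by apply: (@trange_mul _ A); rewrite -[k.+1]addn1 texpD /=; congr (_ *E _);
   apply: tmx_inj; rewrite tmxM tmx1 mulmx1.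
Qed.

(** One exponent with stable range suffices for a least one to exist, so [xget] does not fall back
    on its default. *)
Lemma is_tind_tind A k U : A ^E k.+1 *E U = A ^E k -> is_tind A (tind A).
Proof.
move=> eqU; apply: (@xgetPex _ 0%N [set k | is_tind A k]%classic).
have exk : exists k, `[< trange (A ^E k) = trange (A ^E k.+1) >].
  by exists k; apply/asboolP/trange_expS; exists U.
exists (ex_minn exk); case: ex_minnP => l /asboolP eql minl.
by split=> // j eqj; apply/minl/asboolP.
Qed.

Lemma is_drazin_exists A : exists X, is_drazin A X.
Proof.
have [k [g cg akg]] := mx_strongly_pi_regular (tmx A).
have [[l alx] xax cax] := ring_drazin_exists cg akg.
have [X XE] := tmx_surj (tmx A ^+ k * g ^+ k.+1).
rewrite -XE in alx xax cax.
have alX : A ^E l.+1 *E X = A ^E l by apply: tmx_inj; rewrite tmxM !tmxX.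
have [/trange_expS[U eqU] _] := is_tind_tind alX.
exists X; split; apply: tmx_inj; [|by rewrite !tmxM..].
(* The power equation is known only at [l] but is required at the index [t]. Writing
   [a^t = a^(t+l) u^l] raises the exponent enough to absorb [X], after which the same identity
   brings it back down. *)
rewrite tmxM !tmxX; set t := tind A in eqU *; pose u := tmx U; pose a := tmx A.
have atu : a ^+ t.+1 * u = a ^+ t by rewrite -!tmxX -[_ * _]tmxM eqU.
have cX n : a ^+ n * tmx X = tmx X * a ^+ n.
  by apply: commr_sym; apply: commrX; apply: commr_sym.
have alx' : a ^+ (t + l).+1 * tmx X = a ^+ (t + l).
  by apply: ring_drazin_expr_le alx; rewrite leq_addl.
rewrite -/a -[LHS]/(a ^+ t.+1 * tmx X) cX exprS -{1}(mul_expr_stable l atu).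
by rewrite (mulrA a) -exprS mulrA -cX alx' mul_expr_stable.
Qed.

Lemma drazinP A : ring_drazin (tmx A) (tmx (drazin A)).
Proof.
have [] := @xgetPex _ 0 _ (is_drazin_exists A).
rewrite -/(drazin A) => ax xax cax; split.
- by exists (tind A); rewrite -!tmxX -[LHS]tmxM ax.
- by rewrite -[in RHS]xax !tmxM.
- by rewrite /GRing.comm -[LHS]tmxM cax tmxM.
Qed.

End TensorMatrix.

(** * The weighted equations for rectangular matrices *)

Section WeightedDrazin.

Variables (F : fieldType) (m n : nat) (B : 'M[F]_(m, n)) (W : 'M[F]_(n, m)).

Lemma mulmx_exprC k : (B *m W) ^+ k *m B = B *m (W *m B) ^+ k.
Proof.
elim: k => [|k IHk]; first by rewrite mul1mx mulmx1.
by rewrite !exprSr -!mulmxE -mulmxA -(mulmxA B) mulmxA IHk !mulmxA.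
Qed.

Definition mx_wdrazin (X : 'M[F]_(m, n)) : Prop :=
  [/\ exists k : nat, (0 < k)%N /\
        (B *m W) ^+ k.+1 *m X *m W = (B *m W) ^+ k,
      X = X *m W *m B *m W *m X
    & B *m W *m X = X *m W *m B].

Lemma mx_wdrazin_drazin (D : 'M[F]_n) :
  ring_drazin ((W *m B) ^+ 2) D -> mx_wdrazin (B *m D).
Proof.
move=> drD; have [[k ckD] DcD cD] := drD.
have cCD : W *m B *m D = D *m (W *m B).
  by apply: (ring_drazin_comm drD); apply: commrX.
rewrite -!exprM mulnS in ckD.
split.
(* From [(W B)^(2k+2) D = (W B)^(2k)], the outer [B] and [W] add one factor [B W], whence the odd,
   and thus positive, exponent. *)
- exists (2 * k).+1; split=> //.
  rewrite mulmxA mulmx_exprC -(mulmxA B) [X in B *m X]ckD.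
  by rewrite -mulmx_exprC exprSr -mulmxE mulmxA.
- by rewrite -[in LHS]DcD expr2 -!mulmxE !mulmxA.
- by rewrite -!mulmxA (mulmxA W B D) cCD.
Qed.

Lemma mx_wdrazin_ring_drazin (X : 'M[F]_(m, n)) :
  mx_wdrazin X -> ring_drazin (B *m W) (X *m W).
Proof.
case=> [[k [_ akX]] XE cX]; split.
- by exists k; rewrite -mulmxE mulmxA.
- by rewrite -!mulmxE [in RHS]XE !mulmxA.
- by rewrite /GRing.comm -!mulmxE mulmxA cX -!mulmxA.
Qed.

Lemma mx_wdrazinE (X : 'M[F]_(m, n)) :
  mx_wdrazin X -> X = X *m W *m (X *m W) *m B.
Proof.
case=> [_ XE cX]; rewrite [LHS]XE -!mulmxA; congr (_ *m (_ *m _)).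
by rewrite mulmxA cX mulmxA.
Qed.

End WeightedDrazin.

Lemma is_wdrazin_tmx (C : fieldType) (M N : nat) (I : 'I_M -> nat)
    (J : 'I_N -> nat) (B : tensor C I J) (W : tensor C J I) (X : tensor C I J) :
  is_wdrazin B W X <-> mx_wdrazin (tmx B) (tmx W) (tmx X).
Proof.
split=> -[[k [k0 akX]] XE cX]; split.
- by exists k; split=> //; rewrite -!tmxM -!tmxX -!tmxM akX.
- by rewrite -!tmxM -XE.
- by rewrite -!tmxM cX.
- by exists k; split=> //; apply: tmx_inj; rewrite 2!tmxM !tmxX tmxM.
- by apply: tmx_inj; rewrite !tmxM.
- by apply: tmx_inj; rewrite !tmxM.
Qed.

Theorem theorem4p7 (R : realType) (M N : nat) (hM : (0 < M)%N) (hN : (0 < N)%N)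
  (I : 'I_M -> nat) (J : 'I_N -> nat)
  (hI : forall s : 'I_M, (0 < I s)%N) (hJ : forall s : 'I_N, (0 < J s)%N)
  (B : tensor R[i] I J) (W : tensor R[i] J I) :
  unique (is_wdrazin B W) (B *E drazin ((W *E B) ^E 2)).
Proof.
set X0 := B *E _.
have wX0 : mx_wdrazin (tmx B) (tmx W) (tmx X0).
  rewrite tmxM; apply: mx_wdrazin_drazin; rewrite -tmxM -tmxX.
  exact: drazinP.
split=> [|X /is_wdrazin_tmx wX]; first exact/is_wdrazin_tmx.
(* Both sides take the form [Y Y B], with [Y] a Drazin inverse of [B W]. *)
apply: tmx_inj; rewrite (mx_wdrazinE wX0) (mx_wdrazinE wX).
have -> // := ring_drazin_unique (mx_wdrazin_ring_drazin wX0)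
                (mx_wdrazin_ring_drazin wX).
Qed.
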